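(* Let $m\ge n\ge 1$ be integers. Consider the block version of musical chairs with $m$ chairs and $n$ players described in the context, and let $R$ be the total number of rejections suffered by all players, summed over all $m^n$ samples. Then $$R=\frac12\left(n^{\underline{2}}m^{n-1}+n^{\underline{3}}m^{n-2}+n^{\underline{4}}m^{n-3}+\cdots\right)=\frac12\sum_{k=2}^{n} n^{\underline{k}}\,m^{n-k+1}.$$ Equivalently, the average number of rejections per player, $\frac{R}{n m^n}$ (the sample being uniformly random), equals $$\frac{1}{2n}\left(\frac{n^{\underline{2}}}{m}+\frac{n^{\underline{3}}}{m^{2}}+\frac{n^{\underline{4}}}{m^{3}}+\cdots\right).$$
   Context: Notation: $n^{\underline{i}}=\binom{n}{i}i!$ (which is $0$ for $i>n$). The game. There are $m$ chairs in a circle, numbered clockwise $0,\dots,m-1$ (chair arithmetic is modulo $m$), and $n$ distinguishable players, $m\ge n$, who are totally ranked in advance. A sample $S$ is an assignment of each player to a chair, his initial chair; there are $m^n$ samples. For each chair $j$, the (possibly empty) set of players with initial chair $j$ is the $j$-th block of $S$. Seating process. All blocks start simultaneously at their initial chairs and travel clockwise at the same speed, one chair per time step. Each block, as long as it is nonempty, loses exactly one member to each vacant chair it visits (including, at time $0$, its own initial chair); the member who takes the chair is the highest-ranked of the players remaining in the block. The chair at which a player is seated is his final chair. Rejections. A player suffers one rejection for each chair that he visits (starting with his initial chair, travelling with his block) strictly before reaching his final chair. Each such chair is occupied by some other player, possibly one from the player's own block who has just taken that chair. *)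

(* Defs.v *)
From mathcomp Require Import all_boot all_order all_algebra all_fingroup.

Set Implicit Arguments.
Unset Strict Implicit.
Unset Printing Implicit Defensive.

Local Open Scope nat_scope.

(* A sample gives each of the n players his initial chair.  The ranking is an
   arbitrary permutation [rank] of the players; the player p with the smallest
   [rank p] is the highest-ranked one. *)
Definition sample (m n : nat) := {ffun 'I_n -> 'I_m}.

(* [f p] is the final chair of p, or [None] while p has not been seated. *)
Definition seating (m n : nat) := {ffun 'I_n -> option 'I_m}.

Definition vacant (m n : nat) (f : seating m n) (c : 'I_m) : bool :=
  [forall q, f q != Some c].

(* The players remaining in the j-th block. *)
Definition remaining (m n : nat) (S : sample m n) (f : seating m n) (j : 'I_m)
  : {set 'I_n} := [set q | (S q == j) && (f q == None)].

(* The chair visited at time t by the j-th block; [ordS] is the successor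
   modulo m on ['I_m]. *)
Definition visited (m : nat) (j : 'I_m) (t : nat) : 'I_m := iter t (@ordS m) j.

Definition highest (n : nat) (rank : 'S_n) (A : {set 'I_n}) (p : 'I_n) : bool :=
  (p \in A) && [forall q in A, rank p <= rank q].

(* What happens at time t.  Distinct blocks visit distinct chairs, so the
   simultaneous moves of the blocks do not interfere. *)
Definition seat_step (m n : nat) (rank : 'S_n) (S : sample m n) (t : nat)
    (f : seating m n) : seating m n :=
  [ffun p => if vacant f (visited (S p) t)
                && highest rank (remaining S f (S p)) p
             then Some (visited (S p) t) else f p].

(* The situation just before the moves of time t. *)
Fixpoint seating_at (m n : nat) (rank : 'S_n) (S : sample m n) (t : nat)
  : seating m n :=
  if t is t'.+1 then seat_step rank S t' (seating_at rank S t')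
  else [ffun=> None].

(* At each time t at which p is still unseated after the moves of time t, he is
   rejected by the chair [visited (S p) t].  If n <= m, everybody is seated
   within one lap (lemma [all_seated] below), so that counting the times t < m
   counts all the chairs visited by p strictly before his final chair. *)
Definition rejections (m n : nat) (rank : 'S_n) (S : sample m n) (p : 'I_n)
  : nat := #|[set t : 'I_m | seating_at rank S t.+1 p == None]|.

Definition total_rejections (m n : nat) (rank : 'S_n) : nat :=
  \sum_(S : sample m n) \sum_(p < n) rejections rank S p.

Lemma visitedE (m : nat) (j : 'I_m) (t : nat) : visited j t = (j + t) %% m :> nat.
Proof.
elim: t => [|t IH]; first by rewrite /= addn0 modn_small.
by rewrite /visited /= -/(visited j t) IH -addn1 modnDml addn1 addnS.
Qed.

Lemma seated_stable (m n : nat) (rank : 'S_n) (S : sample m n) (s t : nat)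
    (p : 'I_n) (c : 'I_m) :
  s <= t -> seating_at rank S s p = Some c -> seating_at rank S t p = Some c.
Proof.
move=> le_st Hs; elim: t le_st => [|t IH]; first by rewrite leqn0 => /eqP <-.
rewrite leq_eqVlt => /predU1P[<- //|/IH{}IH].
by rewrite /= ffunE /highest inE IH andbF /= andbF.
Qed.

Lemma all_seated (m n : nat) (rank : 'S_n) (S : sample m n) (p : 'I_n) :
  n <= m -> seating_at rank S m p != None.
Proof.
move=> le_nm; apply/eqP => Np.
have Nt t : t <= m -> seating_at rank S t p = None.
  by move=> le_tm; case E: (seating_at rank S t p) => [c|//];
     rewrite (seated_stable le_tm E) in Np.
have occ (c : 'I_m) : exists q, seating_at rank S m q == Some c.
  have [t lt_tm <-] : exists2 t, t < m & visited (S p) t = c.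
    exists ((c + (m - S p)) %% m); first by rewrite ltn_pmod // (leq_ltn_trans _ (ltn_ord c)).
    apply: val_inj; rewrite /= visitedE modnDmr addnCA subnKC ?(ltnW (ltn_ord _)) //.
    by rewrite modnDr modn_small.
  set f := seating_at rank S t; set c' := visited _ _.
  case Hv: (vacant f c'); last first.
    move/forallPn: Hv => [q]; rewrite negbK => /eqP Hq.
    by exists q; rewrite (seated_stable (ltnW lt_tm) Hq).
  have pA : p \in remaining S f (S p) by rewrite inE eqxx /f Nt // ltnW.
  have [q qA qmin] : exists2 q, q \in remaining S f (S p)
      & forall r, r \in remaining S f (S p) -> rank q <= rank r.
    by case: (arg_minnP (fun q => rank q : nat) pA) => q; exists q.
  have Sq : S q = S p by move: qA => /[!inE] /andP[/eqP].
  exists q; apply/eqP; apply: (seated_stable lt_tm).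
  rewrite /= ffunE Sq -/f -/c' Hv /highest qA /=.
  by case: ifP => // /negP[]; apply/forall_inP.
pose g c := xchoose (occ c).
have gP c : seating_at rank S m (g c) = Some c by exact/eqP/(xchooseP (occ c)).
have g_inj : injective g.
  by move=> c d E; have := gP c; rewrite E gP => -[].
have : codom g \subset [set~ p].
  by apply/subsetP => _ /codomP[c ->]; rewrite !inE; apply/eqP => E; have := gP c; rewrite E Np.
move/subset_leq_card; rewrite card_codom // cardsC1 !card_ord => le_mn.
by have := leq_trans le_nm le_mn; case: n p {rank S le_nm Np Nt occ g gP g_inj le_mn} => [[] //|k] _; rewrite ltnn.
Qed.

(* Main.v *)
Require Import Defs.
From mathcomp Require Import all_boot all_order all_algebra all_fingroup.
From mathcomp Require Import zify ring.

Import GRing.Theory.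

Set Implicit Arguments.
Unset Strict Implicit.
Unset Printing Implicit Defensive.

(** The chairs are read as the successive instants of a cyclic queue: the block
    of chair [c] joins the queue at [c], one waiting player is served (seated)
    there, and the others go on to the next chair.  Let [F c] be the number of
    players that chair [c] rejects ([flow]) and [b c] the size of the block of
    [c].  Rejections can be counted chair by chair, so the total for a sample is
    the sum of [F] ([sum_rejections]).  Three facts on [F] suffice.

    - It obeys the queue recursion [F (c + 1) = (F c + b (c + 1)).-1]
      ([flow_ordS]), and it vanishes somewhere, namely at the chair of a player
      who is seated last ([flow_zero]).  Hence [F] is determined by [b], so that
      games with different players and rankings can be compared.

    - Squaring the recursion and summing around the circle, the squares cancel
      and leave
      [2 * \sum_c F c = \sum_p (2 * F (S p - 1) + (b (S p) - 1))]
      ([double_sum_flow]).  In words, under first-come first-served a player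
      waits for the queue that he finds and, on average, for half of the other
      members of his block.

    - The queue that [p] finds is not affected by [p] himself, since with at
      most as many players as chairs nobody goes round to his own starting point
      ([flow_remove]).  It can therefore be computed in the game without [p].

    A sample for [n + 1] players is an initial chair for [p] together with a
    sample for the [n] others.  Summing the second fact over all samples thus
    gives, for the totals [R n],
    [2 * R (n + 1) = (n + 1) * (2 * R n + n * m ^ n)] ([total_rejectionsS]), and
    the falling factorial sum satisfies the same recursion. *)

Local Open Scope nat_scope.

(** * Counting rejections by chairs *)

Definition block_size (m n : nat) (S : sample m n) (c : 'I_m) : nat :=
  \sum_(p < n) (S p == c).

Definition unseated (m n : nat) (rank : 'S_n) (S : sample m n) (t : nat)
    (p : 'I_n) : bool := seating_at rank S t p == None.

(** Players who come to [c] and do not yet have a seat when they come; those who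
    start at [c] are included.  Times below [m] cover exactly one lap, so that
    each player counts at most once. *)
Definition arrivals (m n : nat) (rank : 'S_n) (S : sample m n) (c : 'I_m) :=
  \sum_(p < n) \sum_(t < m) ((visited (S p) t == c) && unseated rank S t p).

Definition flow (m n : nat) (rank : 'S_n) (S : sample m n) (c : 'I_m) :=
  \sum_(p < n) \sum_(t < m) ((visited (S p) t == c) && unseated rank S t.+1 p).

Lemma sum_rejections (m n : nat) (rank : 'S_n) (S : sample m n) :
  \sum_(p < n) rejections rank S p = \sum_(c < m) flow rank S c.
Proof.
rewrite /flow [RHS]exchange_big; apply: eq_bigr => p _ /=.
rewrite exchange_big /rejections -sum1_card big_mkcond; apply: eq_bigr => t _ /=.
rewrite (bigD1 (visited (S p) t)) //= eqxx /= big1 ?addn0; last first.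
  by move=> c; rewrite eq_sym => /negbTE->.
by rewrite inE /unseated /=; case: (_ == _).
Qed.

Lemma unseatedS (m n : nat) (rank : 'S_n) (S : sample m n) t p :
  unseated rank S t.+1 p -> unseated rank S t p.
Proof.
rewrite /unseated; case E: (seating_at rank S t p) => [c|//].
by rewrite (seated_stable (leqnSn t) E).
Qed.

(** * The seating process at one chair *)

Lemma newly_seated (m n : nat) (rank : 'S_n) (S : sample m n) t p c :
    unseated rank S t p -> seating_at rank S t.+1 p = Some c ->
  [/\ c = visited (S p) t, vacant (seating_at rank S t) c
     & highest rank (remaining S (seating_at rank S t) (S p)) p].
Proof.
rewrite /unseated /= ffunE => /eqP Np; case: ifP => [/andP[? ?] [<-] // | _].
by rewrite Np.
Qed.

Lemma visited_chair_taken (m n : nat) (rank : 'S_n) (S : sample m n) t p :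
    unseated rank S t p ->
  exists q, seating_at rank S t.+1 q = Some (visited (S p) t).
Proof.
move=> Np; set f := seating_at rank S t; set c := visited _ _.
case Hv: (vacant f c); last first.
  move/forallPn: Hv => [q]; rewrite negbK => /eqP Hq.
  by exists q; rewrite (seated_stable (leqnSn t) Hq).
have pA : p \in remaining S f (S p) by rewrite inE eqxx.
have [q qA qmin] : exists2 q, q \in remaining S f (S p)
    & forall r, r \in remaining S f (S p) -> rank q <= rank r.
  by case: (arg_minnP (fun q => rank q : nat) pA) => q; exists q.
have Sq : S q = S p by move: qA => /[!inE] /andP[/eqP].
exists q; rewrite /= ffunE Sq -/f -/c Hv /highest qA /=.
by case: ifP => // /negP[]; apply/forall_inP.
Qed.

Lemma final_chair_inj (m n : nat) (rank : 'S_n) (S : sample m n) t p q c :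
    seating_at rank S t p = Some c -> seating_at rank S t q = Some c ->
  p = q.
Proof.
elim: t p q => [|t IH] p q; first by rewrite ffunE.
have fresh x y : unseated rank S t x -> seating_at rank S t.+1 x = Some c ->
    seating_at rank S t.+1 y = Some c -> unseated rank S t y.
  move=> Nx Hx Hy; have [_ /forallP/(_ y) + _] := newly_seated Nx Hx.
  rewrite /unseated; case E: (seating_at rank S t y) => [d|//].
  by rewrite -Hy (seated_stable (leqnSn t) E) eqxx.
move=> Hp Hq; case Np: (unseated rank S t p).
  have Nq := fresh p q Np Hp Hq.
  have [cp _ /andP[pA /forall_inP pmin]] := newly_seated Np Hp.
  have [cq _ /andP[qA /forall_inP qmin]] := newly_seated Nq Hq.
  (* Both come to c at the same time, hence from the same block. *)
  have Spq : S p = S q.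
    have: visited (S p) t = visited (S q) t by rewrite -cp.
    by elim: (t) => //= s IHs /ordS_inj/IHs.
  rewrite -Spq in qA qmin; apply: (@perm_inj _ rank); apply: val_inj.
  by apply/eqP; rewrite eqn_leq pmin ?qmin.
have Nq : unseated rank S t q = false.
  by apply: contraFF Np => Nq; apply: fresh Nq Hq Hp.
move: Np Nq; rewrite /unseated.
case Ep: (seating_at rank S t p) => [d|//] _.
case Eq: (seating_at rank S t q) => [d'|//] _.
rewrite (seated_stable (leqnSn t) Ep) in Hp.
rewrite (seated_stable (leqnSn t) Eq) in Hq.
by apply: IH; [rewrite Ep Hp | rewrite Eq Hq].
Qed.

(** The players who come to a chair are those rejected by the previous chair and
    those who start there.  Shifting the time by one would lose the rejections
    at time [m - 1], but there are none, because everybody is seated by then. *)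
Lemma arrivals_ordS (m n : nat) (rank : 'S_n) (S : sample m n) (c : 'I_m) :
    n <= m ->
  arrivals rank S (ordS c) = flow rank S c + block_size S (ordS c).
Proof.
case: m S c => [|m] S c le_nm; first by case: c.
rewrite /arrivals /flow /block_size -big_split; apply: eq_bigr => p _ /=.
rewrite big_ord_recl big_ord_recr /=.
(* On the left the first term is the initial chair; on the right the last is 0. *)
rewrite /unseated (negbTE (all_seated rank S p le_nm)) andbF addn0 addnC.
rewrite ffunE eqxx andbT; congr (_ + _); apply: eq_bigr => t _.
by rewrite /= inj_eq //; exact: ordS_inj.
Qed.

(** Someone who comes unseated to [c] either is rejected there or ends there. *)
Lemma arrivals_flow (m n : nat) (rank : 'S_n) (S : sample m n) (c : 'I_m) :
  arrivals rank S c
    = flow rank S c + \sum_(p < n) (seating_at rank S m p == Some c).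
Proof.
rewrite /arrivals /flow -big_split; apply: eq_bigr => p _ /=.
suff upto k : \sum_(t < k) ((visited (S p) t == c) && unseated rank S t p)
    = \sum_(t < k) ((visited (S p) t == c) && unseated rank S t.+1 p)
      + (seating_at rank S k p == Some c) by apply: upto.
elim: k => [|k IH]; first by rewrite !big_ord0 ffunE.
rewrite !big_ord_recr /= IH.
rewrite -!addnA; congr (_ + _).
case Ek: (unseated rank S k p); last first.
  have -> : unseated rank S k.+1 p = false.
    by apply/negP => /unseatedS; rewrite Ek.
  rewrite !andbF addn0 add0n; move/negbT: Ek; rewrite /unseated.
  case E: (seating_at _ _ _ p) => [d|//] _.
  by rewrite -/(seating_at rank S k.+1) (seated_stable (leqnSn k) E).
rewrite andbT (eqP Ek) /= add0n -/(seating_at rank S k.+1).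
case E: (seating_at rank S k.+1 p) => [d|]; rewrite /unseated E ?andbT ?addn0 //=.
by have [<- _ _] := newly_seated Ek E; rewrite andbF add0n.
Qed.

(** A chair that is visited at all ends up with exactly one occupant. *)
Lemma flow_pred_arrivals (m n : nat) (rank : 'S_n) (S : sample m n) (c : 'I_m) :
  flow rank S c = (arrivals rank S c).-1.
Proof.
have [A0|A_gt0] := posnP (arrivals rank S c).
  by move: (arrivals_flow rank S c); rewrite A0; case: flow.
suff taken: \sum_(p < n) (seating_at rank S m p == Some c) = 1.
  by rewrite arrivals_flow taken addn1.
have [q Hq] : exists q, seating_at rank S m q = Some c.
  move: A_gt0; rewrite lt0n sum_nat_eq0 => /forallPn[p].
  rewrite sum_nat_eq0 => /forallPn[t]; rewrite eqb0 negbK => /andP[/eqP <- Nt].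
  have [q Hq] := visited_chair_taken Nt.
  by exists q; apply: seated_stable Hq.
rewrite (bigD1 q) //= Hq eqxx big1 // => p ne_pq; apply/eqP; rewrite eqb0.
by apply: contraNneq ne_pq => Hp; rewrite (final_chair_inj Hp Hq).
Qed.

(** * The queue recursion *)

Lemma flow_ordS (m n : nat) (rank : 'S_n) (S : sample m n) (c : 'I_m) :
    n <= m ->
  flow rank S (ordS c) = (flow rank S c + block_size S (ordS c)).-1.
Proof. by move=> le_nm; rewrite flow_pred_arrivals arrivals_ordS. Qed.

(** Take a player [p] who is seated last, at time [t], on chair [c].  Anyone
    rejected by [c] was there before [t], as all are seated after [t]; but then
    [c] was taken before [t], whereas [p] found it vacant. *)
Lemma flow_zero (m n : nat) (rank : 'S_n) (S : sample m n) :
  0 < m -> n <= m -> exists c, flow rank S c = 0.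
Proof.
case: n rank S => [|n] rank S m_gt0 le_nm.
  by exists (Ordinal m_gt0); rewrite /flow big_ord0.
have ex_t : exists t, [forall p, ~~ unseated rank S t p].
  by exists m; apply/forallP => p; apply: all_seated.
case: (ex_minnP ex_t) => -[|t] /forallP all_t minT.
  by have := all_t ord0; rewrite /unseated ffunE.
have le_tm : t < m by apply: minT; apply/forallP => p; apply: all_seated.
have /forallPn[p /negPn Np] : ~~ [forall p, ~~ unseated rank S t p].
  by apply/negP => /minT; rewrite ltnn.
case Ep: (seating_at rank S t.+1 p) (all_t p) => [c|]; last by rewrite /unseated Ep.
move=> _; have [_ /forallP vac _] := newly_seated Np Ep.
exists c; rewrite /flow big1 // => q _; rewrite big1 // => s _; apply/eqP.
rewrite eqb0; apply/negP => /andP[/eqP vis Nq].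
have lt_st : s < t.
  rewrite ltnNge; apply/negP => le_ts; have := all_t q; rewrite /unseated.
  case E: (seating_at rank S t.+1 q) => [d|//].
  by move: Nq; rewrite /unseated (@seated_stable _ _ _ _ t.+1 s.+1 _ _ _ E).
have [r Hr] := visited_chair_taken (unseatedS Nq).
by have := vac r; rewrite -vis (seated_stable lt_st Hr) eqxx.
Qed.

(** The recursion is monotone in [flow] and in the block sizes, so a comparison
    propagates clockwise from a zero of the smaller flow.  The two games may have
    different players and rankings. *)
Lemma flow_le (m n n' : nat) (rank : 'S_n) (rank' : 'S_n')
    (S : sample m n) (S' : sample m n') (z : 'I_m) (k : nat) :
    n <= m -> n' <= m -> flow rank S z = 0 ->
    (forall i, i < k -> block_size S (visited z i.+1)
                          <= block_size S' (visited z i.+1)) ->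
  flow rank S (visited z k) <= flow rank' S' (visited z k).
Proof.
move=> le_nm le_n'm Fz; elim: k => [|k IH] le_b; first by rewrite /= Fz.
rewrite /= !flow_ordS //; have := le_b k (leqnn _).
have := IH (fun i lt_ik => le_b i (ltnW lt_ik)); rewrite /=; lia.
Qed.

Lemma visited_surj (m : nat) (z c : 'I_m) : exists k, visited z k == c.
Proof.
exists (c + (m - z)); apply/eqP; apply: val_inj; rewrite /= visitedE.
by rewrite addnCA subnKC ?(ltnW (ltn_ord _)) // modnDr modn_small.
Qed.

(** Of two games that differ by one player starting at [a], both leave the same
    queue just before [a]: going clockwise from a zero of the larger flow to the
    predecessor of [a], one need not cross [a], and elsewhere the block sizes
    agree. *)
Lemma flow_remove (m n n' : nat) (rank : 'S_n) (rank' : 'S_n')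
    (S : sample m n) (S' : sample m n') (a : 'I_m) :
    n <= m -> n' <= m ->
    (forall c, block_size S c = (a == c) + block_size S' c) ->
  flow rank S (ord_pred a) = flow rank' S' (ord_pred a).
Proof.
move=> le_nm le_n'm bE; apply/eqP; rewrite eqn_leq; apply/andP; split.
  have [z Fz] := flow_zero rank S (leq_ltn_trans (leq0n _) (ltn_ord a)) le_nm.
  (* A shortest walk from z to the predecessor of a does not step onto a. *)
  case: (ex_minnP (visited_surj z (ord_pred a))) => k /eqP vk mink.
  rewrite -vk; apply: flow_le => // i lt_ik; rewrite bE.
  case: eqP => // a_def; have := mink i; rewrite leqNgt lt_ik.
  by rewrite -[visited z i]ordSK a_def eqxx => /(_ isT).
have [z Fz] := flow_zero rank' S' (leq_ltn_trans (leq0n _) (ltn_ord a)) le_n'm.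
have [k /eqP <-] := visited_surj z (ord_pred a).
by apply: flow_le => // i _; rewrite bE leq_addl.
Qed.

(** * The quadratic identity *)

Lemma sum_block_size (m n : nat) (S : sample m n) (g : 'I_m -> nat) :
  \sum_(c < m) block_size S c * g c = \sum_(p < n) g (S p).
Proof.
under eq_bigr do rewrite /block_size big_distrl /=.
rewrite exchange_big; apply: eq_bigr => p _ /=.
rewrite (bigD1 (S p)) //= eqxx mul1n big1 ?addn0 // => c.
by rewrite eq_sym => /negbTE->.
Qed.

(** If [A] players come to a chair that rejects [F = A.-1] of them, then
    [F * F.+1 = A * A.-1] (also for [A = 0]).  With [A = F' + b], where [F'] is
    the previous flow, the terms [F ^ 2] and [F' ^ 2] cancel around the circle. *)
Lemma double_sum_flow (m n : nat) (rank : 'S_n) (S : sample m n) :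
    n <= m ->
  2 * \sum_(c < m) flow rank S c
    = \sum_(p < n) (2 * flow rank S (ord_pred (S p)) + (block_size S (S p)).-1).
Proof.
move=> le_nm; rewrite -(sum_block_size S
  (fun c => 2 * flow rank S (ord_pred c) + (block_size S c).-1)).
set F := flow rank S; set b := block_size S.
have sumS (g : 'I_m -> nat) : \sum_(c < m) g (ordS c) = \sum_(c < m) g c.
  by rewrite [RHS](reindex_inj (@ordS_inj m)).
have sq c : F (ordS c) ^ 2 + (F (ordS c) + F c)
    = F c ^ 2 + b (ordS c) * (2 * F (ord_pred (ordS c)) + (b (ordS c)).-1).
  rewrite ordSK {1 2}/F flow_ordS // -/F -/b; nia.
have /eqP := eq_bigr (fun=> _) (fun c (_ : true) => sq c) : 
  \sum_(c < m) _ = \sum_(c < m) _.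
rewrite !big_split /= (sumS (fun c => F c ^ 2)) (sumS F) eqn_add2l addnn -mul2n.
by rewrite (sumS (fun c => b c * (2 * F (ord_pred c) + (b c).-1))) => /eqP.
Qed.

(** * Recursion on the number of players *)

Definition remove_player (m n : nat) (p : 'I_n.+1) (S : sample m n.+1)
  : sample m n := [ffun i => S (lift p i)].

Lemma block_size_remove (m n : nat) (p : 'I_n.+1) (S : sample m n.+1) c :
  block_size S c = (S p == c) + block_size (remove_player p S) c.
Proof.
rewrite /block_size (@bigD1_ord _ _ _ _ p) //=; congr (_ + _).
by apply: eq_bigr => i _; rewrite ffunE.
Qed.

Lemma sum_remove_player (m n : nat) (p : 'I_n.+1) (g : 'I_m -> sample m n -> nat) :
  \sum_(S : sample m n.+1) g (S p) (remove_player p S)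
    = \sum_(S' : sample m n) \sum_(c < m) g c S'.
Proof.
rewrite pair_big /=.
pose add_player (x : sample m n * 'I_m) : sample m n.+1 :=
  [ffun q => if unlift p q is Some i then x.1 i else x.2].
rewrite (reindex add_player) /=.
  apply: eq_bigr => -[S' c] _ /=; rewrite ffunE unlift_none /=.
  by congr (g _ _); apply/ffunP => i; rewrite !ffunE liftK.
exists (fun S => (remove_player p S, S p)) => [[S' c]|S] _.
  rewrite ffunE unlift_none /=.
  by congr (_, _); apply/ffunP => i; rewrite !ffunE liftK.
by apply/ffunP => q; rewrite ffunE; case: unliftP => [i|] -> //=; rewrite ffunE.
Qed.

(** By [double_sum_flow] and [flow_remove], the contribution of player [p] depends
    only on his initial chair and on the sample of the others.  As his chair
    varies, the flows add up to all rejections of the others, and the sizes of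
    the blocks that he joins to [n]. *)
Lemma total_rejectionsS (m n : nat) (rank : 'S_n.+1) (rank' : 'S_n) :
    n < m ->
  2 * total_rejections m rank
    = n.+1 * (2 * total_rejections m rank' + n * m ^ n).
Proof.
move=> lt_nm; have le_nm := ltnW lt_nm.
pose g c (S' : sample m n) := 2 * flow rank' S' (ord_pred c) + block_size S' c.
transitivity (\sum_(S : sample m n.+1) \sum_(p < n.+1) g (S p) (remove_player p S)).
  rewrite /total_rejections big_distrr; apply: eq_bigr => S _ /=.
  rewrite sum_rejections double_sum_flow //; apply: eq_bigr => p _.
  rewrite (flow_remove rank rank' lt_nm le_nm (block_size_remove p S)).
  by rewrite (block_size_remove p) eqxx.
rewrite exchange_big /=; under eq_bigr do rewrite (sum_remove_player _ g).
rewrite sum_nat_const card_ord; congr (_ * _).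
have sum_b (S' : sample m n) : \sum_(c < m) block_size S' c = n.
  under eq_bigr do rewrite -[block_size _ _]muln1.
  by rewrite (sum_block_size S' (fun=> 1)) sum1_card card_ord.
under eq_bigr => S' _.
  rewrite big_split /= sum_b -big_distrr /= -[X in 2 * X]/(\sum_c (fun c => flow rank' S' (ord_pred c)) c).
  rewrite (reindex_inj (@ordS_inj m)) /=; under eq_bigr do rewrite ordSK.
  rewrite -sum_rejections; over.
rewrite big_split /= -big_distrr /= sum_nat_const card_ffun !card_ord.
by rewrite mulnC [m ^ n * n]mulnC mulnC.
Qed.

Lemma double_total_rejections (m n : nat) (rank : 'S_n) : n <= m ->
  2 * total_rejections m rank
    = \sum_(2 <= k < n.+1) n ^_ k * m ^ (n - k + 1).
Proof.
elim: n rank => [|n IH] rank le_nm.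
  rewrite big_geq // /total_rejections big1 ?muln0 // => S _.
  by rewrite big_ord0.
rewrite (total_rejectionsS rank 1%g le_nm) IH ?(ltnW le_nm) //.
case: n {IH rank le_nm} => [|n]; first by rewrite !big_geq.
rewrite [RHS]big_ltn // [in RHS]big_add1 /= mulnDr addnC; congr (_ + _).
  by rewrite ffactnS ffactn1 /= mulnA; congr (_ * m ^ _); lia.
rewrite big_distrr /=; apply: eq_bigr => k _.
by rewrite ffactSS mulnA subSS.
Qed.

Local Open Scope ring_scope.

Theorem mainTheorem1 (m n : nat) (rank : 'S_n) (hn : (1 <= n)%N) (hmn : (n <= m)%N) :
  (total_rejections m rank)%:R
    = 2^-1 * \sum_(2 <= k < n.+1) (n ^_ k * m ^ (n - k + 1))%N%:R :> rat
  /\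
  (total_rejections m rank)%:R / (n * m ^ n)%N%:R
    = (2 * n%:R)^-1 * \sum_(2 <= k < n.+1) ((n ^_ k)%N%:R / m%:R ^+ k.-1) :> rat.
Proof.
have total : (total_rejections m rank)%:R
    = 2^-1 * \sum_(2 <= k < n.+1) (n ^_ k * m ^ (n - k + 1))%N%:R :> rat.
  by rewrite -natr_sum -(double_total_rejections rank hmn) natrM mulKf.
have m_neq0 : m%:R != 0 :> rat.
  by rewrite Num.Theory.pnatr_eq0 -lt0n (leq_trans hn).
split=> //; rewrite {}total.
have <- : (\sum_(2 <= k < n.+1) (n ^_ k * m ^ (n - k + 1))%N%:R) / (m ^ n)%N%:R
    = \sum_(2 <= k < n.+1) ((n ^_ k)%N%:R / m%:R ^+ k.-1) :> rat.
  rewrite mulr_suml; apply: eq_big_nat => k /andP[le2k le_kn].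
  rewrite natrM -mulrA; congr (_ * _).
  have -> : (m ^ n = m ^ (n - k + 1) * m ^ k.-1)%N.
    by rewrite -expnD; congr (_ ^ _)%N; lia.
  by rewrite natrM invfM mulVKf ?natrX // expf_neq0.
by rewrite natrM !invfM; ring.
Qed.
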